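(* Let $a,b,n$ be non-negative integers and let $p$ be a prime. Suppose that at least one of the following holds: (i) $p$ divides none of the integers $n-a$, $n-2a+b$, $a-b$, $n$, $a^2-nb-a+b$; (ii) $p\mid n-a$, $p\nmid n-2a+b$ and $p\nmid n-1$. Then for any $(a,b)$-town$\pmod p$ family $\mathcal{F}\subseteq\mathscr{P}(n)$ we have $|\mathcal{F}|\leq n-1$.
   Context: $[n]=\{1,2,\ldots,n\}$ for a positive integer $n$, with the convention $[0]=\emptyset$, and $\mathscr{P}(n)$ is the power set of $[n]$; a family $\mathcal{F}\subseteq\mathscr{P}(n)$ is a set of (distinct) subsets of $[n]$. For integers $k\ge 2$ and $a,b$ (only their residues modulo $k$ matter), a family $\mathcal{F}\subseteq\mathscr{P}(n)$ is an $(a,b)$-town$\pmod k$ if for any distinct $A,B\in\mathcal{F}$ we have $|A|\equiv a\pmod k$ and $|A\cap B|\equiv b\pmod k$; that is, every set in $\mathcal{F}$ has cardinality $\equiv a\pmod k$ and every intersection of two distinct sets of $\mathcal{F}$ has cardinality $\equiv b\pmod k$.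
   Formalization: The formal theorem assumes n is positive; for n = 0 the claim fails, since (ii) can hold (e.g. p = 2, a = 0, b = 1) while no family has at most −1 members. *)

(* Defs.v *)
From mathcomp Require Import all_boot all_order all_algebra.

Set Implicit Arguments.
Unset Strict Implicit.
Unset Printing Implicit Defensive.

(* The ground set [n] = {1, ..., n} is represented by 'I_n = {0, ..., n-1}. *)
Definition is_town (k : nat) (a b : int) (n : nat) (F : {set {set 'I_n}}) : Prop :=
  (forall A : {set 'I_n}, A \in F -> (#|A|%:Z = a %[mod k%:Z])%Z) /\
  (forall A B : {set 'I_n}, A \in F -> B \in F -> A != B ->
     (#|A :&: B|%:Z = b %[mod k%:Z])%Z).

(* Main.v *)
Require Import Defs.
From mathcomp Require Import all_boot all_order all_algebra.
From mathcomp Require Import ring.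

Set Implicit Arguments.
Unset Strict Implicit.
Unset Printing Implicit Defensive.

Import Order.TTheory GRing.Theory Num.Theory.
Local Open Scope ring_scope.

(** Suppose the town had [n] members. Their incidence matrix [M] over ['F_p] is
    square, with [M M^T = (a - b) I + b J] and all row sums equal to [a].
    If [x M = t 1], taking inner products with the rows of [M] and with [1]
    gives linear equations relating [x], its coordinate sum and [t].
    In case (i) they force [x = 0] and [t = 0], so [M] is invertible and yet [1]
    is not in its row space. In case (ii), applied to the complementary
    incidence matrix [W = J - M], they show that [W] is invertible, although
    its row sums [n - a] vanish. *)

Section IncidenceMatrix.

Variables (K : fieldType) (n : nat) (a b : K) (M : 'M[K]_n).
Hypotheses (row_sum : forall i, \sum_k M i k = a)
  (gram : forall i j, \sum_k M i k * M j k = if i == j then a else b).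

Lemma row_comb_sum (x : 'rV[K]_n) t :
  (forall k, (x *m M) 0 k = t) -> (\sum_i x 0 i) * a = t * n%:R.
Proof.
move=> xM; transitivity (\sum_k (x *m M) 0 k); last first.
  by rewrite (eq_bigr (fun=> t)) ?sumr_const ?card_ord ?mulr_natr.
under [RHS]eq_bigr => k _ do rewrite mxE.
rewrite exchange_big mulr_suml; apply: eq_bigr => i _.
by rewrite -mulr_sumr row_sum.
Qed.

(** The inner product of [x M = t 1] with row [j] is computed twice: through the row sum it is
    [t * a], and through [gram] the terms [i != j] contribute [b] and the term [i = j] contributes
    [a]. *)
Lemma row_comb_gram (x : 'rV[K]_n) t j :
  (forall k, (x *m M) 0 k = t) ->
  (a - b) * x 0 j + b * (\sum_i x 0 i) = t * a.
Proof.
move=> xM; transitivity (\sum_i x 0 i * \sum_k M i k * M j k); last first.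
  under eq_bigr => i _ do rewrite mulr_sumr.
  rewrite exchange_big -(row_sum j) mulr_sumr; apply: eq_bigr => k _ /=.
  by rewrite -(xM k) mxE mulr_suml; apply: eq_bigr => i _; rewrite mulrA.
under [RHS]eq_bigr => i _ do rewrite gram.
rewrite (bigD1 j) //= (bigD1 j (P := predT)) //= eqxx.
rewrite [X in _ = _ + X](_ : _ = b * \sum_(i | i != j) x 0 i).
  by ring.
by rewrite mulr_sumr; apply: eq_bigr => i /negPf->; rewrite mulrC.
Qed.

(** Summing [row_comb_gram] over [j] eliminates the single coordinates and leaves a relation between
    the coordinate sum and [t]. *)
Lemma row_comb_gram_sum (x : 'rV[K]_n) t :
  (forall k, (x *m M) 0 k = t) ->
  (a - b + n%:R * b) * (\sum_i x 0 i) = n%:R * (t * a).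
Proof.
move=> xM; transitivity (\sum_(j < n) t * a); last first.
  by rewrite sumr_const card_ord mulr_natl.
under [RHS]eq_bigr => j _ do rewrite -(row_comb_gram j xM).
rewrite big_split /= -mulr_sumr sumr_const card_ord -[_ *+ n]mulr_natl.
by ring.
Qed.

Lemma unitmx_row_kernel0 (A : 'M[K]_n) :
  (forall x : 'rV_n, x *m A = 0 -> x = 0) -> A \in unitmx.
Proof.
move=> inj; rewrite -row_free_unit -kermx_eq0; apply/rowV0P => x.
by move/sub_kermxP/inj.
Qed.

Lemma town_matrix_false : a - b != 0 -> n%:R != 0 :> K ->
  a ^+ 2 - n%:R * b - a + b != 0 -> False.
Proof.
move=> ab_neq0 n_neq0 disc_neq0.
have trivial_comb (x : 'rV_n) t :
    (forall k, (x *m M) 0 k = t) -> x = 0 /\ t = 0.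
  move=> xM; have sum_eq := row_comb_sum xM.
  have s0 : \sum_i x 0 i = 0.
    (* Replacing [t * n] by [s * a], with [s] the coordinate sum, removes [t] and gives
       [(a - b + n b) s = a^2 s], that is, [s] times the nonzero quantity of [disc_neq0]
       vanishes. *)
    have := row_comb_gram_sum xM; rewrite mulrA [n%:R * t]mulrC -sum_eq => e.
    apply: (mulfI disc_neq0); rewrite mulr0.
    rewrite -[RHS](subrr ((\sum_i x 0 i) * a * a)) -{2}e.
    by ring.
  have t0 : t = 0.
    by apply: (mulIf n_neq0); rewrite -sum_eq s0 !mul0r.
  split=> //; apply/rowP => j; rewrite mxE; apply: (mulfI ab_neq0).
  by have := row_comb_gram j xM; rewrite s0 t0 !(mulr0, mul0r, addr0).
have Mu : M \in unitmx.
  apply: unitmx_row_kernel0 => x xM0.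
  by have [|->] := trivial_comb x 0 => // k; rewrite xM0 mxE.
(* The invertible [M] would express the all-ones vector by its rows, with [t = 1], against
   [t = 0]. *)
have [k|_ /eqP] := trivial_comb (const_mx 1 *m invmx M) 1.
  by rewrite mulmxKV // mxE.
by rewrite oner_eq0.
Qed.

Lemma complement_town_matrix_false : (0 < n)%N -> a - b != 0 ->
  n%:R = a -> n%:R - 1 != 0 :> K -> False.
Proof.
move=> n_gt0 ab_neq0 n_eq_a n1_neq0.
pose W : 'M[K]_n := const_mx 1 - M.
have Wu : W \in unitmx.
  apply: unitmx_row_kernel0 => x xW0; set s := \sum_i x 0 i.
  (* [x J = s 1], so [x W = 0] means [x M = t 1] with [t = s]. *)
  have xM k : (x *m M) 0 k = s.
    apply/esym/eqP; rewrite -subr_eq0; apply/eqP.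
    have := congr1 (fun y : 'rV_n => y 0 k) xW0; rewrite mulmxBr !mxE.
    by under eq_bigr => i _ do rewrite mxE mulr1.
  have x_s j : x 0 j = s.
    apply: (mulfI ab_neq0); apply: (addIr (b * s)).
    by rewrite (row_comb_gram j xM); ring.
  (* All [n] coordinates of [x] equal their own sum, so [s = n s]. *)
  have s0 : s = 0.
    apply: (mulfI n1_neq0); rewrite mulr0 mulrBl mul1r.
    apply/eqP; rewrite subr_eq0; apply/eqP.
    by rewrite {2}/s (eq_bigr (fun=> s)) // sumr_const card_ord mulr_natl.
  by apply/rowP => j; rewrite x_s s0 mxE.
have W1 : W *m (const_mx 1 : 'cV_n) = 0.
  apply/colP => i; rewrite !mxE.
  under eq_bigr => k _ do rewrite !mxE mulr1.
  by rewrite sumrB row_sum sumr_const card_ord n_eq_a subrr.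
have := congr1 (mulmx (invmx W)) W1; rewrite mulKmx // mulmx0.
move/colP/(_ (Ordinal n_gt0)); rewrite !mxE.
by apply/eqP/oner_neq0.
Qed.

End IncidenceMatrix.

Lemma sum_indicator (R : pzSemiRingType) (T : finType) (A : {set T}) :
  \sum_x (x \in A)%:R = #|A|%:R :> R.
Proof. by rewrite -natr_sum -big_mkcond /= sum1_card. Qed.

Lemma eqz_mod_pcharf (R : nzRingType) (p : nat) (x y : int) :
  p \in [pchar R] -> (x = y %[mod p%:Z])%Z -> x%:~R = y%:~R :> R.
Proof.
move=> charR /eqP; rewrite eqz_mod_dvd (dvdz_pcharf charR) rmorphB subr_eq0.
by move/eqP.
Qed.

Theorem proposition2p5 (a b n p : nat) (hn : (0 < n)%N) (hp : prime p)
  (h :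
    [/\ ~~ (p%:Z %| n%:Z - a%:Z)%Z,
        ~~ (p%:Z %| n%:Z - 2 * a%:Z + b%:Z)%Z,
        ~~ (p%:Z %| a%:Z - b%:Z)%Z,
        ~~ (p%:Z %| n%:Z)%Z
      & ~~ (p%:Z %| a%:Z ^+ 2 - n%:Z * b%:Z - a%:Z + b%:Z)%Z]
    \/
    [/\ (p%:Z %| n%:Z - a%:Z)%Z,
        ~~ (p%:Z %| n%:Z - 2 * a%:Z + b%:Z)%Z
      & ~~ (p%:Z %| n%:Z - 1)%Z])
  (F : {set {set 'I_n}}) (hF : is_town p a%:Z b%:Z F) :
  (#|F| <= n - 1)%N.
Proof.
have [sizeF interF] := hF.
rewrite leqNgt subn1 prednK //; apply/negP => n_le_F.
have charF := pchar_Fp hp.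
(* The first [n] members of [F] in its enumeration index the rows of a square matrix. *)
pose f (i : 'I_n) : {set 'I_n} := enum_val (widen_ord n_le_F i).
have f_inj : injective f by move=> i j /enum_val_inj [] /val_inj.
have fF i : f i \in F by apply: enum_valP.
pose M : 'M['F_p]_n := \matrix_(i, k) (k \in f i)%:R.
have row_sum i : \sum_k M i k = a%:R.
  under eq_bigr => k _ do rewrite mxE.
  by rewrite sum_indicator; apply: (eqz_mod_pcharf charF (sizeF _ (fF i))).
have gram i j : \sum_k M i k * M j k = if i == j then a%:R else b%:R.
  transitivity (#|f i :&: f j|%:R : 'F_p).
    rewrite -sum_indicator; apply: eq_bigr => k _.
    by rewrite !mxE inE -natrM mulnb.
  case: eqP => [-> | /eqP ij].
    by rewrite setIid; apply: (eqz_mod_pcharf charF (sizeF _ (fF j))).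
  apply: (eqz_mod_pcharf charF (interF _ _ (fF i) (fF j) _)).
  by rewrite (inj_eq f_inj).
case: h => [[_ _] | []]; rewrite !(dvdz_pcharf charF).
  rewrite !(rmorphB, rmorphD, rmorphM, rmorphXn) /= => ab_neq0 n_neq0 disc_neq0.
  exact: (town_matrix_false row_sum gram).
rewrite !(rmorphB, rmorphD, rmorphM) /= subr_eq0 => /eqP n_eq_a c_neq0 n1_neq0.
apply: (complement_town_matrix_false row_sum gram hn _ n_eq_a n1_neq0).
(* Modulo [p], [n = a] turns [n - 2a + b] into [-(a - b)]. *)
apply: contraNneq c_neq0 => ab0; apply/eqP.
rewrite n_eq_a -[RHS]oppr0 -ab0; ring.
Qed.
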